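(* Let $K,L,M$ be positive integers and let $W$ be a random variable with values in $\{0,1,2,\dots\}$ and $\mathbb{E}[W]<\infty$. Consider the synchronous, collocated slotted ALOHA radar network with chirp length $K$ slots, $L$ chirps per packet and generic backoff $W$. Suppose the tagged radar starts a packet in slot $t_1$. For $i\in\{-(L-1),\dots,L-1\}$ let $E_i$ be the event that a given interfering radar starts a packet transmission in slot $t_1+iK$. (1) In a two-radar network, the interference probability at the tagged radar, $p_{I2}=\mathbb{P}\big(\bigcup_{i=-(L-1)}^{L-1}E_i\big)$, is $$p_{I2}=\frac{2L-1}{KL+\mathbb{E}[W]}-\frac{1}{KL+\mathbb{E}[W]}\sum_{i=1}^{L-1}(L-i)\,\mathbb{P}\big(W=(i-1)K\big).$$ (2) In an $M$-radar network, the interference probability $p_I$ at the tagged radar, i.e. the probability that for at least one of the $M-1$ other radars one of the corresponding events $E_i$ occurs, is $$p_I=1-(1-p_{I2})^{M-1}.$$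
   Context: Slotted ALOHA: time is divided into slots indexed by $\mathbb{Z}$. Each radar repeats transmission cycles: it transmits a packet of $L$ contiguous chirps, each lasting $K$ slots (so a packet occupies $KL$ consecutive slots), then stays silent (backoff) for a random number of slots, then starts its next packet in the slot immediately after the backoff, and so on. Successive backoffs of a radar are i.i.d. copies of $W$, and different radars evolve independently. Stationarity: each interfering radar is in its stationary regime, i.e. the set of slots in which it starts a packet is a stationary renewal process on $\mathbb{Z}$ with inter-start times distributed as $KL+W$. So the probability that it starts a packet in any given slot is $\frac{1}{KL+\mathbb{E}[W]}$ (the long-run fraction of slots in which a packet starts), and given a packet start in some slot, the subsequent backoffs are i.i.d. copies of $W$. The interfering radars are independent of the tagged radar and of each other. Interference (synchronous, collocated: zero clock offsets and zero propagation delays): a chirp of the tagged radar is interfered with if and only if some chirp of another radar starts in the same slot. The tagged radar suffers interference if at least one of the $L$ chirps of its packet is interfered with. The events that cause this are exactly $E_{-(L-1)},\dots,E_{L-1}$ (for each interfering radar). *)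

(* Defs.v *)
From HB Require Import structures.
From mathcomp Require Import all_boot all_order all_algebra.
From mathcomp Require Import all_classical all_reals all_analysis.

Set Implicit Arguments.
Unset Strict Implicit.
Unset Printing Implicit Defensive.

Import Order.TTheory GRing.Theory Num.Theory.
Import numFieldNormedType.Exports.

Local Open Scope classical_set_scope.
Local Open Scope ring_scope.

(* [backoffs_from D x t b]: along the path [x] ([x s] means that a packet starts
   in slot [s]), a packet starts in slot [t] and the backoffs that follow it are,
   in order, the entries of [b]; [D] is the number of slots of a packet. Thus a
   backoff of [n] slots after a start in [t] means that the next start is in
   slot [t + D + n]. *)
Fixpoint backoffs_from (D : nat) (x : int -> bool) (t : int) (b : seq nat) : Prop :=
  x t /\
  if b is n :: b' then
    (forall s : int, t < s < t + (D + n)%:Z -> ~~ x s) /\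
    backoffs_from D x (t + (D + n)%:Z) b'
  else True.

Section Radar.
Context {d : measure_display} {T : measurableType d} {R : realType}.
Variable P : probability T R.

(* The random set of slots in which a radar starts a packet, through its
   indicator process. *)
Definition radar : Type := int -> {RV P >-> bool}.

Definition starts (X : radar) (t : int) : set T := [set w | X t w].

(* The joint law of (X_k), k in F, does not change when time is shifted by h. *)
Definition stationary (X : radar) : Prop :=
  forall (F : seq int) (e : int -> bool) (h : int),
    P [set w | forall k, k \in F -> X (h + k) w = e k] =
    P [set w | forall k, k \in F -> X k w = e k].

Definition starts_unbounded (X : radar) : Prop :=
  {ae P, forall w, forall t : int,
    (exists2 s : int, s <= t & X s w) /\ (exists2 s : int, t <= s & X s w)}.

Context {dW : measure_display} {TW : measurableType dW}.
Variable PW : probability TW R.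

(* Given a packet start in slot t, the subsequent backoffs are i.i.d. copies of W
   (conditioning is written in product form). *)
Definition iid_backoffs_after (D : nat) (W : {RV PW >-> nat}) (X : radar)
    (t : int) : Prop :=
  forall b : seq nat,
    P [set w | backoffs_from D (fun s => X s w) t b] =
    (P (starts X t) * \prod_(n <- b) PW [set v | W v = n])%E.

(* Stationary renewal process on the integers with inter-start times D + W. *)
Definition stationary_renewal (D : nat) (W : {RV PW >-> nat}) (X : radar) : Prop :=
  [/\ stationary X, starts_unbounded X & forall t, iid_backoffs_after D W X t].

(* The sigma-algebra generated by the process of a radar. *)
Definition radar_events (X : radar) : set (set T) :=
  <<s [set starts X t | t in [set: int]] >>.

Definition mutually_independent (I : finType) (X : I -> radar) : Prop :=
  forall (J : {set I}) (A : I -> set T),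
    (forall r, r \in J -> radar_events (X r) (A r)) ->
    P (\bigcap_(r in [set r | r \in J]) A r) = (\prod_(r in J) P (A r))%E.

(* A network of M radars observed from the radar [tag], which starts a packet in
   slot t1. The tagged radar is not stationary: the law P is the one given its
   packet start in t1, and its backoffs are i.i.d. from t1 on. *)
Definition aloha_network (K L M : nat) (W : {RV PW >-> nat})
    (X : 'I_M -> radar) (tag : 'I_M) (t1 : int) : Prop :=
  [/\ {ae P, forall w, X tag t1 w},
      iid_backoffs_after (K * L) W (X tag) t1,
      forall r, r != tag -> stationary_renewal (K * L) W (X r)
    & mutually_independent X].

(* The union of the events E_i, - (L - 1) <= i <= L - 1, of an interfering radar X. *)
Definition interference (K L : nat) (t1 : int) (X : radar) : set T :=
  \bigcup_(i in [set i : int | - (L%:Z - 1) <= i <= L%:Z - 1])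
    starts X (t1 + i * K%:Z).

End Radar.

Definition mean_backoff {dW : measure_display} {TW : measurableType dW}
    {R : realType} (PW : probability TW R) (W : {RV PW >-> nat}) : \bar R :=
  'E_PW[fun v => (W v)%:R : R]%E.

(* Main.v *)
(* Slot 0 lies between two consecutive starts, so summing over the position of
   the last start up to it gives 1 = p (D + E[W]), where p is the probability of
   a start in a given slot and D = K L.  Scanning the slots t1 + i K of the union
   from the last one to the first, the inclusion-exclusion corrections are the
   probabilities that a start in slot t1 + i K is followed by another one in a
   slot t1 + i' K with i' > i.  These slots being less than 2 D apart, such starts
   are almost surely consecutive, with backoff (i' - i - L) K. *)
Require Import Defs.
From HB Require Import structures.
From mathcomp Require Import all_boot all_order all_algebra.
From mathcomp Require Import all_classical all_reals all_analysis.
From mathcomp Require Import measurable_realfun.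
From mathcomp Require Import zify ring.

Set Implicit Arguments.
Unset Strict Implicit.
Unset Printing Implicit Defensive.

Import Order.TTheory GRing.Theory Num.Theory.
Import numFieldNormedType.Exports.

Local Open Scope classical_set_scope.
Local Open Scope ring_scope.

(** * Preliminaries on measures and series *)

Lemma measure_negligible_diff (d : measure_display) (T : measurableType d)
    (R : realType) (mu : {measure set T -> \bar R}) (A B : set T) :
  measurable A -> measurable B -> B `<=` A -> mu.-negligible (A `\` B) ->
  mu A = mu B.
Proof.
move=> mA mB BA N; rewrite (measureDI _ mA mB) (setIidr BA).
by rewrite (measure_negligible (measurableD mA mB) N) add0e.
Qed.

(** Serves in [renewal_rate] to count the [D + n] possible positions of the last start when its
    backoff is [n]. *)
Lemma nneseries_if_lt (R : realType) (c : \bar R) (m : nat) : (0 <= c)%E ->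
  (\sum_(k <oo) (if (k < m)%N then c else 0) = (m%:R)%:E * c)%E.
Proof.
move=> c0; rewrite (nneseries_split 0 m); last by move=> k _; case: ifP.
rewrite add0n eseries0 ?adde0; last first.
  by move=> k mk _; rewrite ltnNge mk.
rewrite -[in RHS](subn0 m) -sumr_const_nat -sumEFin ge0_sume_distrl; last first.
  by move=> k _; rewrite lee_fin.
by apply: eq_big_nat => k /andP[_ ->]; rewrite mul1e.
Qed.

(** * Law and mean of the backoff *)

Section NatValued.
Context {d : measure_display} {T : measurableType d} {R : realType}.
Context (P : probability T R) (W : {RV P >-> nat}).

Lemma measurable_fiber n : measurable [set v | W v = n].
Proof.
rewrite (_ : [set _ | _] = W @^-1` [set n]) //.
exact: measurable_funPTI.
Qed.

Lemma trivIset_fiber : trivIset setT (fun n => [set v | W v = n]).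
Proof. by move=> i j _ _ [v [/= <- <-]]. Qed.

Lemma bigcup_fiber : \bigcup_n [set v | W v = n] = setT.
Proof. by apply/seteqP; split=> // v _; exists (W v). Qed.

Lemma sum_prob_fiber : (\sum_(n <oo) P [set v | W v = n] = 1)%E.
Proof.
rewrite -(probability_setT P) -bigcup_fiber measure_semi_bigcup //.
- exact: measurable_fiber.
- exact: trivIset_fiber.
- by rewrite bigcup_fiber.
Qed.

Lemma mean_backoffE :
  mean_backoff W = (\sum_(n <oo) (n%:R)%:E * P [set v | W v = n])%E.
Proof.
rewrite /mean_backoff unlock -bigcup_fiber ge0_integral_bigcup.
- apply: eq_eseriesr => n _.
  rewrite -(integral_cst P (measurable_fiber n)).
  by apply: eq_integral => v; rewrite inE /= => ->.
- exact: measurable_fiber.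
- rewrite bigcup_fiber; apply/measurable_EFinP.
  exact: (measurableT_comp (f := fun n : nat => n%:R : R)).
- by move=> v _; rewrite lee_fin.
- exact: trivIset_fiber.
Qed.

End NatValued.

(** * Stationary renewal process: gaps, rate, spacing of starts *)

Section StationaryRenewal.
Context {d : measure_display} {T : measurableType d} {R : realType}.
Context {P : probability T R}.
Context {dW : measure_display} {TW : measurableType dW}.
Context {PW : probability TW R}.

Definition gap (D : nat) (X : radar P) (t : int) (n : nat) : set T :=
  [set w | backoffs_from D (fun s => X s w) t [:: n]].

Lemma gapE D (X : radar P) t n w : gap D X t n w <->
  [/\ X t w, forall s : int, t < s < t + (D + n)%:Z -> ~~ X s w
    & X (t + (D + n)%:Z) w].
Proof. by split=> [[? [? [? _]]]|[? ? ?]]. Qed.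

Lemma measurable_starts (X : radar P) t : measurable (starts X t).
Proof.
rewrite (_ : starts X t = X t @^-1` [set true]) //.
exact: measurable_funPTI.
Qed.
Hint Resolve measurable_starts : core.

Lemma measurable_gap D (X : radar P) t n : measurable (gap D X t n).
Proof.
rewrite (_ : gap D X t n = starts X t `&`
  \bigcap_(k in [set k | 0 < k < D + n]%N) ~` starts X (t + k%:Z) `&`
  starts X (t + (D + n)%:Z)).
  apply: measurableI => //; apply: measurableI => //.
  by apply: bigcap_measurableType => k _; exact: measurableC.
apply/seteqP; split=> w.
  case/gapE=> Xt Xn Xe; split=> //; split=> // k /= /andP[k0 kn].
  apply/negP/Xn; lia.
move=> [[Xt Xn] Xe]; apply/gapE; split=> // s /andP[ts st].
have := Xn `|s - t|%N; rewrite /starts /= (_ : t + _ = s); last lia.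
by move=> H; apply/negP; apply: H; lia.
Qed.
Hint Resolve measurable_gap : core.

(** The smaller of two backoffs would put a start strictly inside the larger gap; [0 < D] places
    that start after [t]. *)
Lemma trivIset_gap D (X : radar P) t : (0 < D)%N ->
  trivIset setT (gap D X t).
Proof.
move=> D_gt0; suff H i j w : (i < j)%N -> gap D X t i w -> ~ gap D X t j w.
  move=> i j _ _ [w [gi gj]]; case: (ltngtP i j) => // ij.
  - by case: (H _ _ _ ij gi).
  - by case: (H _ _ _ ij gj).
move=> ij /gapE[_ _ Xi] /gapE[_ /(_ (t + (D + i)%:Z)) + _].
by rewrite Xi => /(_ _)/negP; apply => //; lia.
Qed.

Context (D : nat) (W : {RV PW >-> nat}) (X : radar P).
Context (D_gt0 : (0 < D)%N) (hX : stationary_renewal D W X).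

Let q n := PW [set v | W v = n].
Let p := P (starts X 0).

Lemma prob_starts t : P (starts X t) = p.
Proof.
have [st _ _] := hX; have := st [:: 0] (fun=> true) t.
have E s : [set w | forall k, k \in [:: 0] -> X (s + k) w = true] = starts X s.
  apply/seteqP; split=> w /=.
    by move=> /(_ 0); rewrite inE eqxx addr0; apply.
  by move=> Xs k; rewrite inE => /eqP ->; rewrite addr0.
rewrite E => ->; rewrite /p -(E 0); congr (P _).
by apply/seteqP; split=> w /= H k /H; rewrite add0r.
Qed.

Lemma prob_gap t n : P (gap D X t n) = (p * q n)%E.
Proof. by have [_ _ /(_ t [:: n])] := hX; rewrite big_seq1 prob_starts. Qed.

Lemma prob_gaps t : P (\bigcup_n gap D X t n) = p.
Proof.
rewrite measure_semi_bigcup //;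
  [|exact: trivIset_gap|exact: bigcupT_measurable].
transitivity (\sum_(n <oo) (p * q n))%E.
  by apply: eq_eseriesr => n _; exact: prob_gap.
have /fineK <- : p \is a fin_num by exact: fin_num_measure.
by rewrite nneseriesZl // sum_prob_fiber mule1.
Qed.

Lemma gaps_sub_starts t : \bigcup_n gap D X t n `<=` starts X t.
Proof. by move=> w [n _ /gapE[]]. Qed.

(** The gaps lie inside [starts X t] and, the law of [W] having total mass 1, their union has the
    same finite probability [p]. *)
Lemma negligible_no_gap t :
  P.-negligible (starts X t `\` \bigcup_n gap D X t n).
Proof.
have mg : measurable (\bigcup_n gap D X t n) by exact: bigcupT_measurable.
apply/negligibleP; first exact: measurableD.
have : (P (starts X t) = P (starts X t `\` \bigcup_n gap D X t n) +
    P (starts X t `&` \bigcup_n gap D X t n))%E by exact: measureDI.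
rewrite prob_starts (setIidr (@gaps_sub_starts t)) prob_gaps.
have pfin : p \is a fin_num by exact: fin_num_measure.
by move=> /(congr1 (fun x => x - p)%E); rewrite subee // addeK.
Qed.

Lemma measure_starts_setI t (A : set T) : measurable A ->
  P (starts X t `&` A) = (\sum_(n <oo) P (gap D X t n `&` A))%E.
Proof.
move=> mA.
have mg : measurable (\bigcup_n gap D X t n) by exact: bigcupT_measurable.
rewrite -(@measure_semi_bigcup _ _ _ P (fun n => gap D X t n `&` A)).
- rewrite -setI_bigcupl; apply: measure_negligible_diff.
  + exact: measurableI.
  + exact: measurableI.
  + by move=> w [/gaps_sub_starts Xt Aw].
  + apply: negligibleS (negligible_no_gap t) => w [[Xt Aw] nG].
    by split=> // G; apply: nG.
- by move=> n; exact: measurableI.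
- exact/trivIset_setIr/trivIset_gap.
- by apply: bigcupT_measurable => n; exact: measurableI.
Qed.

(* Slot 0 is covered by exactly one interval going from a start (included) to the
   next one (excluded); [last_start k] says that it begins in slot [- k]. *)
Let last_start k : set T :=
  starts X (- k%:Z) `&` \bigcap_(j in [set j | (j < k)%N]) ~` starts X (- j%:Z).

Let measurable_last_start k : measurable (last_start k).
Proof.
apply: measurableI => //; apply: bigcap_measurableType => j _.
exact: measurableC.
Qed.

Let trivIset_last_start : trivIset setT last_start.
Proof.
suff H i j w : (i < j)%N -> last_start i w -> ~ last_start j w.
  move=> i j _ _ [w [gi gj]]; case: (ltngtP i j) => // ij.
  - by case: (H _ _ _ ij gi).
  - by case: (H _ _ _ ij gj).
by move=> ij [Xi _] [_ /(_ i)]; apply.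
Qed.

(** Split by the backoff [n] after the start in [- k]: if [k < D + n], no other start occurs up to
    slot 0; otherwise the next start, in [- k + D + n], rules out [last_start k]. *)
Let prob_last_start k :
  P (last_start k) = (\sum_(n <oo) if (k < D + n)%N then p * q n else 0)%E.
Proof.
rewrite measure_starts_setI; last first.
  by apply: bigcap_measurableType => j _; exact: measurableC.
apply: eq_eseriesr => n _; rewrite -(prob_gap (- k%:Z)).
case: ltnP => kn.
  congr (P _); apply: setIidl => w /gapE[_ Xn _] j /= jk.
  by apply/negP/Xn; lia.
rewrite -[RHS](measure0 P); congr (P _); apply/seteqP; split=> // w.
case=> /gapE[_ _ Xe] /(_ (k - (D + n))%N)/=; apply; first lia.
by rewrite /starts/= (_ : - _ = - k%:Z + (D + n)%:Z) //; lia.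
Qed.

Let prob_bigcup_last_start : P (\bigcup_k last_start k) = 1%E.
Proof.
rewrite -(probability_setT P); apply/esym/measure_negligible_diff => //.
  exact: bigcupT_measurable.
have [_ + _] := hX; apply: negligibleS => w [_ nG] /= H; apply: nG.
have [[s s0 Xs] _] := H 0.
have ex : exists k, X (- k%:Z) w.
  by exists `|s|%N; rewrite (_ : - _ = s) //; lia.
(* The least such [k] locates the last start up to slot 0. *)
case: (ex_minnP ex) => k Xk kmin; exists k => //; split => // j /= jk.
by move=> /kmin; lia.
Qed.

Lemma renewal_rate : (p * ((D%:R)%:E + mean_backoff W) = 1)%E.
Proof.
have p0 : (0 <= p)%E by exact: measure_ge0.
have q0 n : (0 <= q n)%E by exact: measure_ge0.
have /fineK pfin : p \is a fin_num by exact: fin_num_measure.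
rewrite -prob_bigcup_last_start measure_semi_bigcup;
  [|by []|exact: trivIset_last_start|exact: bigcupT_measurable].
rewrite (eq_eseriesr (fun k _ => prob_last_start k)).
(* Tonelli for nonnegative terms: summing over [k] first yields [(D + n) * (p * q n)] for each
   [n]. *)
rewrite nneseries_interchange; last by move=> i j; case: ifP; rewrite ?mule_ge0.
under [RHS]eq_eseriesr => n _.
  rewrite nneseries_if_lt ?mule_ge0 // muleCA natrD EFinD ge0_muleDl ?lee_fin //.
  over.
rewrite -pfin nneseriesZl; last first.
  by move=> n _; rewrite adde_ge0 ?mule_ge0 ?lee_fin.
rewrite nneseriesD; last 2 first.
- by move=> n _ _; rewrite mule_ge0 ?lee_fin.
- by move=> n _ _; rewrite mule_ge0 ?lee_fin.
by rewrite nneseriesZl // sum_prob_fiber mule1 mean_backoffE.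
Qed.

(** Off a countable union of null sets, every start in a slot [t + k] opens a gap of length at least
    [D], with no start strictly inside. *)
Lemma negligible_close_starts t :
  P.-negligible [set w | exists k n : nat,
    [/\ (k < n)%N, (n < k + D)%N, X (t + k%:Z) w & X (t + n%:Z) w]].
Proof.
apply: negligibleS (negligible_bigcup (fun k => negligible_no_gap (t + k%:Z))).
move=> w /= [k [n [kn nkD Xk Xn]]]; exists k => //; split=> // -[b _].
case/gapE=> _ /(_ (t + n%:Z)) + _; rewrite Xn => /(_ _)/negP; apply=> //.
lia.
Qed.

End StationaryRenewal.

(** * Rearrangement of the correction terms *)

(** The term [a m] occurs for [m <= j < l], that is, [l - m] times. *)
Lemma sum_prefix_sums (R : pzRingType) (a : nat -> R) (l : nat) :
  \sum_(j < l) \sum_(m < j.+1) a m = \sum_(m < l) (l - m)%:R * a m.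
Proof.
elim: l => [|l IH]; first by rewrite !big_ord0.
rewrite big_ord_recr/= {}IH [RHS](eq_bigr (fun m : 'I_l.+1 =>
  (l - m)%:R * a m + a m)); last first.
  by move=> m _; rewrite subSn ?leq_ord // -natr1 mulrDl mul1r.
by rewrite big_split/= [in RHS]big_ord_recr/= subnn mul0r addr0.
Qed.

Lemma sum_truncated_prefix_sums (R : pzRingType) (a : nat -> R) (L : nat) :
  (0 < L)%N ->
  \sum_(j < 2 * L - 1) \sum_(m < j.+1 - L) a m =
  \sum_(1 <= i < L) (L - i)%:R * a (i - 1)%N.
Proof.
case: L => // l _; rewrite (_ : 2 * l.+1 - 1 = l.+1 + l)%N; last lia.
(* Truncated subtraction empties the inner sum for the first [L] indices; shifting the others by [L]
   leaves plain prefix sums. *)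
rewrite big_split_ord/= big1 ?add0r => [|j _]; last first.
  by rewrite (_ : _ - _ = 0)%N ?big_ord0 //; case: j => /= j; lia.
transitivity (\sum_(j < l) \sum_(m < j.+1) a m).
  by apply: eq_bigr => j _; rewrite -addnS addKn.
rewrite sum_prefix_sums big_add1 big_mkord.
by apply: eq_bigr => i _; rewrite subSS subn1.
Qed.

(** * Interference caused by a single radar *)

Section Interference.
Context {d : measure_display} {T : measurableType d} {R : realType}.
Context {P : probability T R}.
Context {dW : measure_display} {TW : measurableType dW}.
Context {PW : probability TW R}.
Context (K L : nat) (t1 : int) (W : {RV PW >-> nat}) (X : radar P).
Context (K_gt0 : (0 < K)%N) (L_gt0 : (0 < L)%N).

(** The index runs backwards in time from [i = L - 1], so [later n] gathers the slots of the union
    after [slot n], and induction on [n] adds an earlier slot. *)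
Let slot (j : nat) : int := t1 + (L%:Z - 1 - j%:Z) * K%:Z.
Let later (n : nat) : set T := \bigcup_(j in [set j | (j < n)%N]) starts X (slot j).

Lemma interferenceE : interference K L t1 X =
  \bigcup_(j in [set j | (j < 2 * L - 1)%N]) starts X (t1 + (L%:Z - 1 - j%:Z) * K%:Z).
Proof.
apply/seteqP; split=> w.
  move=> [i /= iL Xi]; exists `|(L%:Z - 1 - i)%R|%N => /=; first lia.
  by rewrite (_ : L%:Z - 1 - _ = i) //; lia.
move=> [j /= jL Xj]; exists (L%:Z - 1 - j%:Z) => //=; lia.
Qed.

Lemma interference_radar_events : radar_events X (interference K L t1 X).
Proof.
rewrite interferenceE bigcup_mkcond; apply: sigma_algebra_bigcup => j.
case: ifP => _; last exact: sigma_algebra0.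
by apply: sub_sigma_algebra; exists (t1 + (L%:Z - 1 - j%:Z) * K%:Z).
Qed.

Lemma measurable_interference : measurable (interference K L t1 X).
Proof.
by rewrite interferenceE; apply: bigcup_measurable => j _; exact: measurable_starts.
Qed.

Context (hX : stationary_renewal (K * L) W X).

Let measurable_later n : measurable (later n).
Proof. by apply: bigcup_measurable => j _; exact: measurable_starts. Qed.

Let p : R := fine (P (starts X 0)).
Let q n : R := fine (PW [set v | W v = n]).

Let D_gt0 : (0 < K * L)%N.
Proof. by rewrite muln_gt0 K_gt0. Qed.

(* The packet of the tagged radar is too short to meet three starts of the same
   radar: a start in [slot j] and another one in the later slots of the union can
   only be consecutive, hence separated by a backoff of [m * K] slots. *)
Let prob_start_later j : (j < 2 * L - 1)%N ->
  P (starts X (slot j) `&` later j) =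
  (p * \sum_(m < j.+1 - L) q (m * K)%N)%:E.
Proof.
move=> jL.
(* A backoff [m * K] after [slot j] leads to [slot (j - L - m)], which requires [L + m <= j]; for
   [j < L] the union is empty. *)
pose B := \big[setU/set0]_(m < j.+1 - L) gap (K * L) X (slot j) (m * K).
have BE w : B w <-> exists2 m, (m < j.+1 - L)%N & gap (K * L) X (slot j) (m * K) w.
  rewrite /B -(bigcup_mkord _ (fun m => gap (K * L) X (slot j) (m * K))).
  by split=> [[m]|[m]]; exists m.
have slotE m : (m < j.+1 - L)%N ->
    slot j + (K * L + m * K)%:Z = slot (j - L - m).
  move=> mj; have [k ->] : exists k, j = (L + m + k)%N.
    by exists (j - L - m)%N; lia.
  rewrite (_ : L + m + k - L - m = k)%N; last lia.
  by rewrite /slot !PoszD !PoszM; ring.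
transitivity (P B).
  apply: measure_negligible_diff.
  - by apply: measurableI => //; exact: measurable_starts.
  - by apply: bigsetU_measurable => m _; exact: measurable_gap.
  - move=> w /BE[m mj /gapE[Xj _]]; rewrite slotE // => Xm.
    by split=> //; exists (j - L - m)%N => //=; lia.
  (* Off this null set, two starts from [slot j] on are at least [K * L] slots apart. *)
  apply: negligibleS (negligible_close_starts D_gt0 hX (slot j)).
  move=> w [[Xj [i /= ij Xi]] nB]; apply: contrapT => far.
  have {far}farP (k n : nat) : (k < n)%N ->
      X (slot j + k%:Z) w -> X (slot j + n%:Z) w -> (k + K * L <= n)%N.
    move=> kn Xk Xn; rewrite leqNgt; apply/negP => nk.
    by apply: far; exists k, n.
  have iE : slot i = slot j + ((j - i) * K)%:Z.
    by rewrite /slot PoszM -subzn; [ring|exact: ltnW].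
  have ji : (0 + K * L <= (j - i) * K)%N.
    apply: farP; [|by rewrite addr0|by rewrite -iE].
    by rewrite muln_gt0 subn_gt0 ij.
  rewrite add0n mulnC leq_pmul2r // in ji.
  (* The spacing gives [L <= j - i], so the backoff between the two starts is [(j - i - L) * K]. *)
  apply: nB; apply/BE; exists (j - i - L)%N; first lia.
  have mE : (K * L + (j - i - L) * K = (j - i) * K)%N.
    by rewrite mulnC -mulnDl subnKC.
  apply/gapE; rewrite mE -iE; split => // s /andP[js si].
  (* A third start in between would force [2 * L <= j - i], against [j < 2 * L - 1]. *)
  apply/negP => Xs; pose k := `|s - slot j|%N.
  have sE : s = slot j + k%:Z by rewrite /k; lia.
  rewrite sE iE in js si.
  have h1 : (0 + K * L <= k)%N by apply: farP; [lia|rewrite addr0|rewrite -sE].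
  have h2 : (k + K * L <= (j - i) * K)%N.
    by apply: farP; [lia|rewrite -sE|rewrite -iE].
  have : (2 * L * K <= (j - i) * K)%N by lia.
  by rewrite leq_pmul2r //; lia.
rewrite measure_bigsetU_ord.
- rewrite mulr_sumr -sumEFin; apply: eq_bigr => m _.
  rewrite EFinM !fineK ?fin_num_measure //.
  - exact: prob_gap hX _ _.
  - exact: measurable_fiber.
  - exact: measurable_starts.
- by move=> m; exact: measurable_gap.
(* Since [K > 0], the backoff [m * K] determines [m]. *)
- move=> m m' _ _ mm'; apply/val_inj/eqP; rewrite -(eqn_pmul2r K_gt0); apply/eqP.
  exact: (trivIset_gap D_gt0) mm'.
Qed.

(** Adding [slot n] to the union adds [p] minus the overlap computed in [prob_start_later]. *)
Let prob_later n : (n <= 2 * L - 1)%N ->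
  P (later n) = (p * \sum_(j < n) (1 - \sum_(m < j.+1 - L) q (m * K)%N))%:E.
Proof.
elim: n => [_|n IH nL].
  rewrite big_ord0 mulr0; transitivity (P set0); last exact: measure0.
  by congr (P _); apply/seteqP; split=> // w [].
have -> : later n.+1 = later n `|` starts X (slot n).
  apply/seteqP; split=> w.
    move=> [j /=]; rewrite ltnS leq_eqVlt => /predU1P[->|jn] Xj; first by right.
    by left; exists j.
  by move=> [[j /= jn Xj]|Xn]; [exists j => //=; exact: ltnW|exists n => /=].
rewrite measureUfinl //; last 2 first.
  exact: measurable_starts.
  by rewrite ltey_eq fin_num_measure.
rewrite setIC big_ord_recr/= mulrDr EFinD -addeA; congr (_ + _)%E.
  by apply: IH; exact: ltnW.
rewrite mulrBr mulr1 EFinB; congr (_ - _)%E; last exact: prob_start_later.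
rewrite fineK; first exact: prob_starts hX _.
by apply: fin_num_measure; exact: measurable_starts.
Qed.

Lemma prob_interference : (mean_backoff W < +oo)%E ->
  let mu : R := (K * L)%:R + fine (mean_backoff W) in
  P (interference K L t1 X) =
  ((2 * L%:R - 1) / mu -
   mu^-1 * \sum_(1 <= i < L) (L - i)%:R * q ((i - 1) * K)%N)%:E.
Proof.
move=> mean_fin mu.
have mean_ge0 : (0 <= mean_backoff W)%E.
  by rewrite mean_backoffE; apply: nneseries_ge0 => n _ _; rewrite mule_ge0 ?lee_fin.
have mu_gt0 : 0 < mu by rewrite ltr_pwDl ?ltr0n ?fine_ge0.
(* Finiteness of the mean turns [renewal_rate] into an equation in [R]. *)
have pE : p = mu^-1.
  have := renewal_rate D_gt0 hX.
  rewrite -(@fineK _ (P _)) ?fin_num_measure //; last exact: measurable_starts.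
  rewrite -(@fineK _ (mean_backoff W)) ?ge0_fin_numE // -EFinD -EFinM => -[].
  by move=> /(canRL (mulfK (lt0r_neq0 mu_gt0))); rewrite mul1r.
rewrite interferenceE; have := @prob_later (2 * L - 1) (leqnn _) => ->.
rewrite pE sumrB (sum_truncated_prefix_sums (fun m => q (m * K)%N)) //.
rewrite mulrBr mulrC; congr (_ * _ - _)%:E.
(* As [L > 0], the truncated [2 * L - 1] casts to the real one. *)
rewrite sumr_const card_ord natrB ?natrM //; lia.
Qed.

End Interference.

(** * Several independent radars *)

Section Independence.
Context {d : measure_display} {T : measurableType d} {R : realType}.
Context {P : probability T R}.

(** Complements stay in the generated sigma-algebras, so the probability of their intersection is a
    product of [M - 1] factors [1 - a]. *)
Lemma prob_bigcup_independent (M : nat) (X : 'I_M -> radar P) (tag : 'I_M)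
    (A : 'I_M -> set T) (a : R) :
  mutually_independent X ->
  (forall r, measurable (A r)) ->
  (forall r, r != tag -> radar_events (X r) (A r)) ->
  (forall r, r != tag -> P (A r) = a%:E) ->
  P (\bigcup_(r in [set r | r != tag]) A r) = (1 - (1 - a) ^+ (M - 1))%:E.
Proof.
move=> indep mA evA PA.
have mU : measurable (\bigcup_(r in [set r | r != tag]) A r).
  by apply: fin_bigcup_measurable => //; exact: finite_finset.
have /(_ (~: [set tag])%SET (fun r => ~` A r)) := indep.
have -> : [set r | r \in (~: [set tag])%SET] = [set r | r != tag].
  by apply/seteqP; split=> r /=; rewrite !inE.
have evAC r : r \in (~: [set tag])%SET -> radar_events (X r) (~` A r).
  by rewrite !inE => /evA; exact: sigma_algebraC.
rewrite -setC_bigcup probability_setC // => /(_ evAC).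
rewrite (eq_bigr (fun=> (1 - a)%:E)); last first.
  by move=> r; rewrite !inE => /PA Pr; rewrite probability_setC // Pr.
rewrite prodEFin prodr_const cardsC1 card_ord -subn1.
rewrite -(@fineK _ (P _)) ?fin_num_measure // -EFinB => -[<-].
by rewrite subKr.
Qed.

End Independence.

Theorem proposition1 (R : realType)
    (d : measure_display) (T : measurableType d) (P : probability T R)
    (dW : measure_display) (TW : measurableType dW) (PW : probability TW R)
    (W : {RV PW >-> nat}) (K L : nat) (t1 : int) :
  (0 < K)%N -> (0 < L)%N -> (mean_backoff W < +oo)%E ->
  let mu : R := (K * L)%:R + fine (mean_backoff W) in
  let pI2 : R :=
    (2 * L%:R - 1) / mu -
    mu^-1 * \sum_(1 <= i < L)
              (L - i)%:R * fine (PW [set v | W v = ((i - 1) * K)%N]) in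
  (forall (X : 'I_2 -> radar P) (tag r : 'I_2),
     aloha_network K L W X tag t1 -> r != tag ->
     P (interference K L t1 (X r)) = (pI2)%:E) /\
  (forall (M : nat) (X : 'I_M -> radar P) (tag : 'I_M),
     (0 < M)%N -> aloha_network K L W X tag t1 ->
     P (\bigcup_(r in [set r | r != tag]) interference K L t1 (X r)) =
     (1 - (1 - pI2) ^+ (M - 1))%:E).
Proof.
move=> K_gt0 L_gt0 mean_fin mu pI2; split.
  move=> X tag r [_ _ ren _] rtag.
  exact: prob_interference (ren r rtag) mean_fin.
move=> M X tag _ [_ _ ren indep]; apply: (prob_bigcup_independent indep) => r.
- exact: measurable_interference.
- by move=> _; exact: interference_radar_events.
- by move=> /ren; move/prob_interference; exact.
Qed.
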